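(* Let $C=\sqrt{\|\frac{1}{\pi}\|_{\infty}}\,\|\frac{\nu}{\pi}-1\|_{2}$ and assume $\beta_1=\beta\in(0,1)$. For $N\in\mathbb{N}$, $n>0$ and $n_0\geq 0$ put $$\mathrm{est}(n,n_0)=\sqrt{\frac{2}{n(1-\beta)}+\frac{2C \beta^{n_0}}{n^2(1-\beta)^2}} .$$ For $\eta>0$ let $$C > \left(\frac{\log(\beta^{-1})}{1-\beta}\right)^{1/\eta},\qquad N > (1+\eta)\,\frac{\log(C)}{\log(\beta^{-1})}+2\,[\log(\beta^{-1})-(1-\beta)]^{-1}.$$ Then there exists an $$n_{\mathrm{opt}}\in\left[\frac{\log(C)}{\log(\beta^{-1})},\,(1+\eta)\frac{\log(C)}{\log(\beta^{-1})}\right]$$ which minimizes the mapping $n_0\mapsto \mathrm{est}(N-n_0,n_0)$ over real $n_0\in[0,N)$.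
   Context: $D$ is a finite set, $P$ is an irreducible, aperiodic transition matrix on $D$ reversible with respect to a probability measure $\pi$ (so $\pi>0$ everywhere), with eigenvalues $1=\beta_0>\beta_1\ge\dots\ge\beta_{|D|-1}$, and $\beta=\max\{\beta_1,|\beta_{|D|-1}|\}$. $\nu$ is a probability measure on $D$ (the initial distribution of the Markov chain). $\|f\|_2=(\sum_{x\in D}f(x)^2\pi(x))^{1/2}$, $\|f\|_\infty=\max_{x\in D}|f(x)|$, and $\frac1\pi$, $\frac\nu\pi$ denote the pointwise quotients. The quantity $\mathrm{est}(n,n_0)$ is an upper bound for the mean square error of the Markov chain Monte Carlo estimator with sample size $n$ and burn-in $n_0$, and $N=n+n_0$ is the total number of steps. Here $n,n_0$ are treated as real variables. *)

(* Defs.v *)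
From HB Require Import structures.
From mathcomp Require Import all_boot all_order all_algebra.
From mathcomp Require Import polyrcf.
From mathcomp Require Import all_classical all_reals all_analysis.

Set Implicit Arguments.
Unset Strict Implicit.
Unset Printing Implicit Defensive.
Import Order.TTheory GRing.Theory Num.Theory.
Local Open Scope ring_scope.

Section MarkovChains.
Variables (R : realType) (D : finType).
Implicit Types (P : D -> D -> R) (m f : D -> R).

Definition is_distr m := (forall x, 0 <= m x) /\ \sum_x m x = 1.

Definition stochastic P := forall x, is_distr (P x).

Definition kernel_mx P : 'M[R]_#|D| :=
  \matrix_(i, j) P (enum_val i) (enum_val j).

Definition kstep P (k : nat) (x y : D) : R :=
  (kernel_mx P ^+ k) (enum_rank x) (enum_rank y).

Definition irreducible P := forall x y, exists k : nat, 0 < kstep P k x y.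

(* The gcd of the return times of x is 1: 1 is their only common divisor. *)
Definition aperiodic P := forall (x : D) (d : nat),
  (forall k : nat, (0 < k)%N -> 0 < kstep P k x x -> (d %| k)%N) -> d = 1%N.

Definition reversible P m := forall x y, m x * P x y = m y * P y x.

(* Real eigenvalues in nonincreasing order, repeated according to their
   algebraic multiplicity ([rootsR] lists the distinct real roots in increasing
   order).  If P is reversible with respect to a positive measure, its
   characteristic polynomial splits over R, so these are all the eigenvalues. *)
Definition eigenvalues P : seq R :=
  rev (flatten [seq nseq (mup b (char_poly (kernel_mx P))) b
               | b <- rootsR (char_poly (kernel_mx P))]).

Definition eigenval P (i : nat) : R := nth 0 (eigenvalues P) i.

Definition beta_max P : R :=
  Num.max (eigenval P 1) `|eigenval P #|D|.-1|.

Definition norm2 m f : R := Num.sqrt (\sum_x f x ^+ 2 * m x).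

Definition norm_inf f : R := \big[Num.max/0]_x `|f x|.

Definition constC (pi_ nu : D -> R) : R :=
  Num.sqrt (norm_inf (fun x => 1 / pi_ x)) *
  norm2 pi_ (fun x => nu x / pi_ x - 1).

End MarkovChains.

Definition est (R : realType) (C beta n n0 : R) : R :=
  Num.sqrt (2 / (n * (1 - beta)) +
            (2 * C * beta `^ n0) / (n ^+ 2 * (1 - beta) ^+ 2)).

(* Main.v *)
(* Up to the factor 2 / g, with g = 1 - beta, the square of est (N - x) x is
   1 / n + C beta^x / (g n^2), where n = N - x.  Write L = ln (1 / beta) > g.
   This decreases while C beta^x >= 1 (i.e. x <= ln C / L) and n >= 2 / (L - g),
   and increases once C beta^x <= g / L, i.e. when x >= (1 + eta) ln C / L.
   Hence a minimum over the compact interval between these two points is a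
   global one.  Both monotonicity claims are comparisons with one endpoint, so
   elementary bounds on exp replace the derivative. *)

Require Import Defs.
From HB Require Import structures.
From mathcomp Require Import all_boot all_order all_algebra.
From mathcomp Require Import all_classical all_reals all_analysis.
From mathcomp Require Import ring lra.
Import Order.TTheory GRing.Theory Num.Theory.
Import numFieldNormedType.Exports.
Local Open Scope ring_scope.

(** With g = 1 - beta, the square of [est] is 2 / g^2 times (g n + C beta^x) / n^2; the hypothesis
    compares these quotients with denominators cleared. *)
Lemma est_le (R : realType) (C beta n n' x x' : R) :
  beta < 1 -> 0 < n -> 0 < n' ->
  ((1 - beta) * n + C * beta `^ x) * n' ^+ 2 <=
    ((1 - beta) * n' + C * beta `^ x') * n ^+ 2 ->
  est C beta n x <= est C beta n' x'.
Proof.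
rewrite -subr_gt0 /est; set g := 1 - beta.
move=> g0 n0 n'0 le_w.
have E m v : 0 < m ->
    2 / (m * g) + 2 * v / (m ^+ 2 * g ^+ 2) =
      2 / g ^+ 2 * ((g * m + v) / m ^+ 2).
  by move=> m0; field; rewrite !gt_eqF.
rewrite -!(mulrA 2 C); apply: ler_wsqrtr; rewrite !E //.
rewrite ler_pM2l ?divr_gt0 ?exprn_gt0 //.
by rewrite ler_pdivrMr ?exprn_gt0 // mulrAC ler_pdivlMr ?exprn_gt0.
Qed.

Lemma sqr_le_expR (R : realType) (u : R) :
  0 <= u -> (1 + u / 2) ^+ 2 <= expR u.
Proof.
move=> u0; rewrite -[leRHS](_ : expR (u / 2) ^+ 2 = _); last first.
  by rewrite expr2 -expRD; congr expR; field.
have := expR_ge1Dx (u / 2).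
nra.
Qed.

(* The comparison of [est_le] with the left endpoint, where C beta^x = 1; here
   n is m at the endpoint and m + d at a point d to its left. *)
Lemma est_cleared_before (R : realType) (L g m d : R) :
  0 <= g -> 0 <= m -> 0 <= d -> 0 <= L -> 2 <= (L - g) * m ->
  (g * m + 1) * (m + d) ^+ 2 <= (g * (m + d) + expR (L * d)) * m ^+ 2.
Proof.
move=> g0 m0 d0 L0 hm.
have Ld0 : 0 <= L * d by apply: mulr_ge0.
have gmd0 : 0 <= g * m * d by rewrite !mulr_ge0.
have hE : (m + L * m * d / 2) ^+ 2 <= expR (L * d) * m ^+ 2.
  have := sqr_le_expR _ _ Ld0.
  move/(ler_wpM2r (sqr_ge0 m)); apply: le_trans.
  by rewrite -exprMn le_eqVlt; apply/orP; left; apply/eqP; field.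
(* By [hm], L m >= 2 + g m. The square of the left side is (m + d)^2 + g m d (m + d), which the goal
   needs, plus the square in [h4]. *)
have h1 : m + d + g * m * d / 2 <= m + L * m * d / 2 by nra.
have h2 : (m + d + g * m * d / 2) ^+ 2 <= (m + L * m * d / 2) ^+ 2.
  by rewrite ler_sqr // nnegrE; nra.
have h3 := le_trans h2 hE.
have h4 : 0 <= (g * m * d / 2) ^+ 2 by exact: sqr_ge0.
lra.
Qed.

(* The comparison of [est_le] with the right endpoint, where C beta^x = w; here
   n is m + d at the endpoint and m at a point d to its right. *)
Lemma est_cleared_after (R : realType) (L g m d w : R) :
  0 <= m -> 0 <= d -> 0 <= w -> w * L <= g ->
  (g * (m + d) + w) * m ^+ 2 <= (g * m + w * expR (- (L * d))) * (m + d) ^+ 2.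
Proof.
move=> m0 d0 w0 wL.
set e := expR _.
have e0 : 0 <= e by exact: expR_ge0.
(* The goal amounts to w (m^2 - e (m + d)^2) <= g m d (m + d), so this bound suffices because w L <=
   g. *)
have key : m ^+ 2 - e * (m + d) ^+ 2 <= L * (m * d * (m + d)).
  have [h|/ltW h] := lerP m (L * d * (m + d)).
    have h1 := ler_wpM2l m0 h.
    have : 0 <= e * (m + d) ^+ 2 by rewrite mulr_ge0 ?sqr_ge0.
    lra.
  have e1 : 1 - L * d <= e by exact: expR_ge1Dx.
  have h1 := ler_wpM2r (sqr_ge0 (m + d)) e1.
  have h2 := ler_wpM2r d0 h.
  have md0 : 0 <= m * d by exact: mulr_ge0.
  have := sqr_ge0 d.
  lra.
have md0 : 0 <= m * d * (m + d) by rewrite !mulr_ge0 ?addr_ge0.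
have h1 := ler_wpM2l w0 key.
have h2 := ler_wpM2r md0 wL.
lra.
Qed.

(** Strictness matters: at beta it gives 1 - beta < ln (1 / beta), so the denominator L - g is
    positive. *)
Lemma ln_lt_subr1 (R : realType) (x : R) : 0 < x -> x != 1 -> ln x < x - 1.
Proof.
move=> x0 x1.
have := @expR_gt1Dx R (ln x); rewrite ln_eq0 // lnK ?posrE // => /(_ x1).
lra.
Qed.

Lemma est_continuous (R : realType) (C beta N x : R) :
  0 < beta < 1 -> x < N ->
  {for x, continuous (fun y => est C beta (N - y) y)}.
Proof.
move=> /andP[b0 b1] xN.
have Nx : N - x != 0 by rewrite subr_eq0 gt_eqF.
have g0 : 1 - beta != 0 by rewrite subr_eq0 gt_eqF.
have cn : ((fun y => N - y) @ x --> N - x)%classic.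
  by apply: cvgB; [exact: cvg_cst|exact: cvg_id].
have cp : ((fun y => beta `^ y) @ x --> beta `^ x)%classic.
  rewrite /powR gt_eqF //; apply: continuous_cvg; first exact: continuous_expR.
  by apply: cvgM; [exact: cvg_id|exact: cvg_cst].
rewrite /est.
apply: continuous_cvg; first exact: sqrt_continuous.
apply: cvgD; apply: cvgM.
- exact: cvg_cst.
- apply: cvgV; first by rewrite mulf_neq0.
  by apply: cvgM => //; exact: cvg_cst.
- by apply: cvgM => //; exact: cvg_cst.
- apply: cvgV; first by rewrite mulf_neq0 ?expf_neq0.
  by apply: cvgM; [rewrite expr2; exact: cvgM|exact: cvg_cst].
Qed.

Theorem lemma2p26 (R : realType) (D : finType) (P : D -> D -> R)
    (pi_ nu : D -> R)
    (hP : stochastic P) (hirr : irreducible P) (haper : aperiodic P)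
    (hpi : is_distr pi_) (hrev : reversible P pi_) (hnu : is_distr nu)
    (beta C : R) (hbeta : beta = beta_max P) (hC : C = constC pi_ nu)
    (hbeta1 : eigenval P 1 = beta) (hbeta0 : 0 < beta) (hbeta_lt1 : beta < 1)
    (N : nat) (eta : R) (heta : 0 < eta)
    (hC_gt : (ln (beta^-1) / (1 - beta)) `^ (1 / eta) < C)
    (hN : (1 + eta) * (ln C / ln (beta^-1))
          + 2 * (ln (beta^-1) - (1 - beta))^-1 < N%:R) :
  exists nopt : R,
    [/\ ln C / ln (beta^-1) <= nopt,
        nopt <= (1 + eta) * (ln C / ln (beta^-1)),
        0 <= nopt < N%:R
      & forall n0 : R, 0 <= n0 < N%:R ->
          est C beta (N%:R - nopt) nopt <= est C beta (N%:R - n0) n0].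
Proof.
set g := 1 - beta; set L := ln (beta^-1); set a := ln C / L.
set b := (1 + eta) * a.
have g0 : 0 < g by rewrite subr_gt0.
have lnb : ln beta = - L by rewrite /L lnV ?posrE // opprK.
have gL : g < L.
  by have := ln_lt_subr1 _ _ hbeta0 (negbT (lt_eqF hbeta_lt1));
     rewrite lnb /g; lra.
have L0 : 0 < L := lt_trans g0 gL.
have Lg0 : 0 < L / g by exact: divr_gt0.
have C0 : 0 < C by apply: le_lt_trans hC_gt; exact: powR_ge0.
have LgC : L / g < C `^ eta.
  rewrite -[ltLHS]powRr1 ?ltW // -(mulVf (lt0r_neq0 heta))
    powRrM -[eta^-1]div1r.
  by apply: gt0_ltr_powR => //; rewrite nnegrE ?powR_ge0 ?ltW.
(* C^eta > L / g > 1, hence C > 1. *)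
have lnC0 : 0 < ln C.
  have : 0 < ln (C `^ eta).
    by apply/ln_gt0/(lt_trans _ LgC); rewrite ltr_pdivlMr ?mul1r.
  by rewrite ln_powR pmulr_rgt0.
have La : L * a = ln C by rewrite /a mulrC divfK ?gt_eqF.
have a0 : 0 < a by exact: divr_gt0.
have ab : a <= b by rewrite /b ler_peMl ?ltW // ltrDl.
have E x : C * beta `^ x = expR (L * (a - x)).
  by rewrite /powR gt_eqF // lnb -{1}(lnK C0) -expRD -La; congr expR; ring.
have Lg_gt0 : 0 < L - g by rewrite subr_gt0.
have bN : b + 2 / (L - g) < N%:R by exact: hN.
have bN' : b < N%:R by apply: lt_trans bN; rewrite ltrDl divr_gt0.
have Ea : C * beta `^ a = 1 by rewrite E subrr mulr0 expR0.
(* Since C beta^b = C^(-eta), this is the lower bound [LgC] on C^eta. *)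
have Eb : C * beta `^ b * L <= g.
  have -> : C * beta `^ b = (C `^ eta)^-1.
    rewrite E /powR gt_eqF // -expRN -La; congr expR; rewrite /b; ring.
  by rewrite mulrC ler_pdivrMr ?powR_gt0 // mulrC -ler_pdivrMr // ltW.
have est_a x : 0 <= x <= a ->
    est C beta (N%:R - a) a <= est C beta (N%:R - x) x.
  move=> /andP[x0 xa]; apply: est_le => //; rewrite ?subr_gt0; [lra|lra|].
  have {1 2}-> : N%:R - x = N%:R - a + (a - x) by ring.
  rewrite Ea E; apply: est_cleared_before; [lra|lra|lra|lra|].
  (* The bound on N enters here: N - a >= N - b > 2 / (L - g). *)
  by rewrite mulrC -ler_pdivrMr //; lra.
have est_b x : b <= x < N%:R ->
    est C beta (N%:R - b) b <= est C beta (N%:R - x) x.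
  move=> /andP[bx xN]; apply: est_le => //; rewrite ?subr_gt0 //.
  have -> : N%:R - b = N%:R - x + (x - b) by ring.
  have -> : C * beta `^ x = C * beta `^ b * expR (- (L * (x - b))).
    by rewrite !E -expRD; congr expR; ring.
  apply: est_cleared_after; rewrite ?subr_ge0 ?(ltW xN) //.
  by rewrite mulr_ge0 ?powR_ge0 // ltW.
have [|c] := @EVT_min R (fun x => est C beta (N%:R - x) x) a b ab.
  apply: continuous_in_subspaceT => x; rewrite inE /= in_itv /= => /andP[_ xb].
  by apply: est_continuous; rewrite ?hbeta0 ?(le_lt_trans xb).
rewrite in_itv /= => /andP[ac cb] hmin; exists c; split => //.
  by rewrite (le_trans (ltW a0) ac) (le_lt_trans cb).
move=> x /andP[x0 xN].
(* Outside [a, b], compare with the nearer endpoint, where the value is at least that at [c]. *)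
have [xa|ax] := leP x a.
  by apply: le_trans (est_a _ _); rewrite ?x0 // hmin // in_itv /= lexx.
have [bx|xb] := leP b x.
  by apply: le_trans (est_b _ _); rewrite ?bx // hmin // in_itv /= lexx ab.
by apply: hmin; rewrite in_itv /= !ltW.
Qed.
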